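(* Let $1 \leq k \leq n$ be integers and consider the absent-minded passengers process with $k$ absent-minded passengers: there are $n$ seats labelled $1,\dots,n$ and $n$ passengers labelled $1,\dots,n$, where the correct seat of passenger $i$ is seat $i$. Passengers board in the order $1,2,\dots,n$. Each of the passengers $1,\dots,k$ chooses a seat uniformly at random among the currently empty seats. Each passenger $i>k$ takes seat $i$ if it is still empty, and otherwise chooses a seat uniformly at random among the currently empty seats. Let $F^{(k)}_n(w_1,\dots,w_n)$ be the multilinear polynomial whose coefficient of $w_{i_1}\cdots w_{i_l}$ (for distinct $i_1,\dots,i_l$) is the probability that the passengers $i_1,\dots,i_l$ all end up in a seat other than their own while every other passenger ends up in his or her own seat. For $0\le r\le k$ let $e_r(w_1,\dots,w_k)$ denote the coefficient of $X^r$ in $\prod_{j=1}^{k}\big((1-w_j)X+w_j\big)$. Then $$F^{(k)}_n(w_1,\dots,w_n)=\frac{1}{n!}\sum_{r=0}^{k} r!\, e_{k-r}(w_1,\dots,w_k)\prod_{j=k+1}^{n}(rw_j+n+1-j).$$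
   Context: $w_1,\dots,w_n$ and $X$ are commuting indeterminates. An empty product equals $1$. *)

(* Defs.v *)
From HB Require Import structures.
From mathcomp Require Import all_boot all_order all_algebra.
From mathcomp Require Import mpoly.

Set Implicit Arguments.
Unset Strict Implicit.
Unset Printing Implicit Defensive.

Import GRing.Theory.
Local Open Scope ring_scope.

(* Passengers and seats are numbered from 0: the ordinal i : 'I_n stands for   *)
(* passenger (and seat) i + 1, so the absent-minded passengers are the i < k.  *)
Definition absent_minded (n k : nat) (i : 'I_n) : bool := (i < k)%N.

(* Probability that passenger i takes seat s when the set of occupied seats is *)
(* occ.                                                                        *)
Definition choice_prob (n k : nat) (occ : {set 'I_n}) (i s : 'I_n) : rat :=
  if ~~ absent_minded k i && (i \notin occ) then (s == i)%:R
  else if s \in occ then 0 else (#|~: occ|%:R)^-1.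

(* A seating f sends each passenger to the seat taken.                         *)
Definition occupied (n : nat) (f : {ffun 'I_n -> 'I_n}) (i : 'I_n) : {set 'I_n} :=
  [set f j | j : 'I_n & (j < i)%N].

(* Chain rule along the boarding order; non-injective f get probability 0.     *)
Definition seating_prob (n k : nat) (f : {ffun 'I_n -> 'I_n}) : rat :=
  \prod_(i < n) choice_prob k (occupied f i) i (f i).

Definition displaced (n : nat) (f : {ffun 'I_n -> 'I_n}) : {set 'I_n} :=
  [set i | f i != i].

Definition displaced_prob (n k : nat) (A : {set 'I_n}) : rat :=
  \sum_(f : {ffun 'I_n -> 'I_n} | displaced f == A) seating_prob k f.

Definition passenger_poly (n k : nat) : {mpoly rat[n]} :=
  \sum_(A : {set 'I_n}) displaced_prob k A *: \prod_(i in A) 'X_i.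

(* The outer polynomial indeterminate is X, the coefficients lie in Q[w].      *)
Definition e_poly (n k r : nat) : {mpoly rat[n]} :=
  (\prod_(j < n | (j < k)%N)
     ((1 - 'X_j)%:P * polyX {mpoly rat[n]} + ('X_j)%:P))`_r.

(* Main.v *)
(* Number the passengers from 0. For a set B of seats below m, sum over the sets
   S of m occupied seats containing B the generating function of the boarding
   from passenger m on. By symmetry of the uniform choices this sum depends on B
   only through r = m - |B|, the number of occupied seats outside B, and it obeys
   a one-step recursion: a passenger m >= k contributes the factor
   (r w_m + n - m)/(n - m), while an absent-minded one, whose weight is written
   w_m + (1 - w_m)[own seat], either raises r, with weight w_m, or adds the own
   seat to B, with weight 1 - w_m. Going back from the end of the boarding, the
   recursion yields first the product over m >= k, then the coefficients of the
   product over m < k. *)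
Require Import Defs.
From HB Require Import structures.
From mathcomp Require Import all_boot all_order all_algebra.
From mathcomp Require Import mpoly.
From mathcomp Require Import ring.

Set Implicit Arguments.
Unset Strict Implicit.
Unset Printing Implicit Defensive.

Import GRing.Theory.
Local Open Scope ring_scope.

(* The passengers before m are frozen at their own seats, so that each course
   of the boarding from passenger m on, with S the seats occupied before, is
   counted once. *)
Definition tail_weight (R : comNzRingType) (n : nat)
    (g : {set 'I_n} -> 'I_n -> 'I_n -> R) (m : nat) (S : {set 'I_n}) : R :=
  \sum_(f : {ffun 'I_n -> 'I_n} | [forall j : 'I_n, (j < m)%N ==> (f j == j)])
     \prod_(i < n | (m <= i)%N)
        g (S :|: [set f j | j : 'I_n & (m <= j < i)%N]) i (f i).

Lemma tail_weight_end (R : comNzRingType) (n : nat)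
    (g : {set 'I_n} -> 'I_n -> 'I_n -> R) (S : {set 'I_n}) :
  tail_weight g n S = 1.
Proof.
rewrite /tail_weight (big_pred1 [ffun j => j]) => [|f].
  by rewrite big_pred0 // => i; rewrite leqNgt ltn_ord.
apply/forallP/eqP => [fid|-> j]; last by rewrite ffunE eqxx implybT.
by apply/ffunP => j; have := fid j; rewrite ltn_ord ffunE => /eqP.
Qed.

(** Condition on the seat [s] of passenger [i]: that choice splits off as a factor, and [s] is
    occupied from then on. *)
Lemma tail_weight_step (R : comNzRingType) (n : nat)
    (g : {set 'I_n} -> 'I_n -> 'I_n -> R) (i : 'I_n) (S : {set 'I_n}) :
  tail_weight g i S = \sum_s g S i s * tail_weight g i.+1 (s |: S).
Proof.
rewrite /tail_weight (partition_big (fun f : {ffun 'I_n -> 'I_n} => f i) xpredT) //=.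
apply: eq_bigr => s _.
pose upd t (f : {ffun 'I_n -> 'I_n}) := [ffun j => if j == i then t else f j].
(* Once [s] is recorded, [i] is frozen at its own seat; [upd s] and [upd i] undo each other. *)
rewrite mulr_sumr (reindex_onto (upd s) (upd i)) => [|f /andP[_ /eqP <-]]; last first.
  by apply/ffunP => j; rewrite !ffunE; case: eqP => // ->.
apply: eq_big => [f|f _].
  rewrite ffunE !eqxx andbT; apply/andP/forallP => [[/forallP fid /eqP fi] j|fid].
    apply/implyP; rewrite ltnS leq_eqVlt => /orP[/eqP/val_inj ->|ltji].
      by rewrite -fi ffunE eqxx.
    by have := fid j; rewrite ltji ffunE -[j == i]val_eqE ltn_eqF.
  split; last first.
    apply/eqP/ffunP => j; rewrite !ffunE; case: eqP => // ->.
    by have := fid i; rewrite ltnSn => /eqP.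
  apply/forallP => j; apply/implyP => ltji.
  by have := fid j; rewrite ltnS ltnW //= ffunE -[j == i]val_eqE ltn_eqF.
rewrite (bigD1 i) //=; congr (_ * _).
  rewrite ffunE eqxx; congr g.
  rewrite (_ : [set _ | _ in _] = set0) ?setU0 //.
  apply/setP => x; rewrite inE; apply/imsetP => -[j]; rewrite inE => /andP[le lt].
  by move: (leq_ltn_trans le lt); rewrite ltnn.
apply: eq_big => [j|j /andP[leij neji]].
  by rewrite ltn_neqAle andbC eq_sym.
have ltij : (i < j)%N by rewrite ltn_neqAle leij andbT eq_sym.
(* For a later passenger [j], the seat [s] is occupied either as the image of [i] or as a member of
   [s |: S]. *)
rewrite [upd s f j]ffunE (negbTE neji); congr g.
apply/setP => x; rewrite !inE.
rewrite -orbA orbCA; congr (_ || _).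
apply/imsetP/orP => [[l]|[/eqP ->|/imsetP[l]]].
- rewrite inE => /andP[leil ltlj] ->; rewrite ffunE.
  have [_|neli] := eqVneq l i; [by left|right].
  by apply/imsetP; exists l => //; rewrite inE ltlj andbT ltn_neqAle leil andbT eq_sym.
- by exists i; rewrite ?inE ?leqnn ?ltij // ffunE eqxx.
- rewrite inE => /andP[ltil ltlj] ->; exists l; first by rewrite inE ltlj ltnW.
  by rewrite ffunE -[l == i]val_eqE gtn_eqF.
Qed.

(** Adding [s] is a bijection between the two families of sets, with removal of [s] as inverse. *)
Lemma sum_setU1 (R : nmodType) (T : finType) (B : {set T}) (m : nat) (s : T)
    (phi : {set T} -> R) (sB : s \notin B) :
  \sum_(S : {set T} | (#|S| == m) && (B \subset S) && (s \notin S)) phi (s |: S) =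
  \sum_(S : {set T} | (#|S| == m.+1) && (s |: B \subset S)) phi S.
Proof.
rewrite [RHS](reindex_onto (fun S => s |: S) (fun S => S :\ s)) => [|S]; last first.
  by case/andP => _; rewrite subUset sub1set => /andP[sS _]; rewrite setD1K.
apply: eq_bigl => S.
have [sS|sS] := boolP (s \in S).
  rewrite andbF; apply/esym/negP => /andP[_ /eqP E].
  by move: sS; rewrite -E !inE eqxx.
rewrite andbT cardsU1 sS add1n eqSS setU1K // eqxx andbT; congr (_ && _).
apply/idP/idP => [/(setUS [set s])//|].
by move/(setSD [set s]); rewrite !setU1K.
Qed.

(** Double counting: a set of size [m.+1] containing [B] arises once for each of its elements
    outside [B], the last one added. *)
Lemma sum_setU1_all (R : pzSemiRingType) (T : finType) (B : {set T}) (m : nat)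
    (phi : {set T} -> R) :
  \sum_(S : {set T} | (#|S| == m) && (B \subset S)) \sum_(s | s \notin S) phi (s |: S) =
  (m.+1 - #|B|)%:R *
    \sum_(S : {set T} | (#|S| == m.+1) && (B \subset S)) phi S.
Proof.
rewrite (exchange_big_dep (fun s => s \notin B)) /=; last first.
  by move=> S s /andP[_ /subsetP BS]; apply: contra => /BS.
under eq_bigr => s sB do rewrite (sum_setU1 _ _ sB).
rewrite (exchange_big_dep (fun S : {set T} => (#|S| == m.+1) && (B \subset S))) /=;
    last first.
  by move=> s S _ /andP[-> ]; rewrite subUset => /andP[].
rewrite mulr_sumr; apply: eq_bigr => S /andP[/eqP cS BS].
rewrite (eq_bigl (mem (S :\: B))) => [|s]; last first.
  by rewrite !inE cS eqxx subUset sub1set BS andbT.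
by rewrite sumr_const cardsD (setIidPr BS) cS mulr_natl.
Qed.

Definition board_weight (A : comAlgType rat) (n k : nat) (w : 'I_n -> A)
    (S : {set 'I_n}) (i s : 'I_n) : A :=
  choice_prob k S i s *: (if s == i then 1 else w i).

Definition tail_sum (A : comAlgType rat) (n k : nat) (w : 'I_n -> A) (m : nat)
    (B : {set 'I_n}) : A :=
  \sum_(S : {set 'I_n} | (#|S| == m) && (B \subset S))
     tail_weight (board_weight k w) m S.

Lemma scale_natVK (A : comAlgType rat) (m : nat) (x : A) :
  (0 < m)%N -> m%:R * ((m%:R)^-1 *: x) = x.
Proof.
move=> m_gt0; rewrite -scalerAr mulr_natl -scaler_nat scalerA mulVf ?scale1r //.
by rewrite Num.Theory.pnatr_eq0 -lt0n.
Qed.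

Lemma card_setC_ord (n m : nat) (S : {set 'I_n}) : #|S| = m -> #|~: S| = (n - m)%N.
Proof. by move=> <-; rewrite cardsCs setCK card_ord. Qed.

Lemma tail_sum_absent (A : comAlgType rat) (n k : nat) (w : 'I_n -> A) (i : 'I_n)
    (B : {set 'I_n}) (i_lt_k : (i < k)%N) (iB : i \notin B) :
  (n - i)%:R * tail_sum k w i B =
    w i * ((i.+1 - #|B|)%:R * tail_sum k w i.+1 B)
    + (1 - w i) * tail_sum k w i.+1 (i |: B).
Proof.
rewrite /tail_sum -sum_setU1_all -(sum_setU1 _ _ iB) !mulr_sumr.
rewrite [X in _ = _ + X]big_mkcondr -big_split /=.
apply: eq_bigr => S /andP[/eqP cS _].
rewrite tail_weight_step; set V := tail_weight _ _.
have n_i : (0 < n - i)%N by rewrite subn_gt0.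
(* Every free seat gets the weight [w i], and the own seat the correction [1 - w i]. The first part
   sums by double counting, the second only over the [S] that avoid [i]. *)
have gE s : (n - i)%:R * (board_weight k w S i s * V (s |: S)) =
   if s \notin S then w i * V (s |: S)
      + (if s == i then (1 - w i) * V (i |: S) else 0) else 0.
  rewrite /board_weight /choice_prob /absent_minded i_lt_k /= (card_setC_ord cS).
  case: (s \in S) => /=; first by rewrite scale0r mul0r mulr0.
  rewrite -scalerAl scale_natVK //; case: eqP => [->|_]; last by rewrite addr0.
  by rewrite -mulrDl addrC subrK.
rewrite mulr_sumr (eq_bigr _ (fun s _ => gE s)) -big_mkcond big_split /=.
congr (_ + _); first by rewrite mulr_sumr.
rewrite big_mkcond (bigD1 i) //= eqxx big1 ?addr0 //.
by move=> s /negbTE ->; case: ifP.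
Qed.

(** Split on whether seat [i] is occupied. If so, [S] contains [i |: B] and double counting applies
    to that set; if not, the passenger sits there with weight 1. Either way seat [i] is occupied
    afterwards. *)
Lemma tail_sum_present (A : comAlgType rat) (n k : nat) (w : 'I_n -> A) (i : 'I_n)
    (B : {set 'I_n}) (k_le_i : (k <= i)%N) (iB : i \notin B) :
  (n - i)%:R * tail_sum k w i B =
    ((i - #|B|)%:R * w i + (n - i)%:R) * tail_sum k w i.+1 (i |: B).
Proof.
have n_i : (0 < n - i)%N by rewrite subn_gt0.
rewrite mulrDl [in X in _ = X + _]mulrAC -[(i - #|B|)%N]subSS.
have <- : #|i |: B| = #|B|.+1 by rewrite cardsU1 iB.
rewrite /tail_sum -sum_setU1_all -(sum_setU1 _ _ iB).
rewrite (bigID (fun S : {set 'I_n} => i \in S)) /= mulrDr.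
congr (_ + _); last first.
  congr (_ * _); apply: eq_bigr => S /andP[_ iS].
  rewrite tail_weight_step (bigD1 i) //= big1 => [|s /negbTE si].
    by rewrite /board_weight /choice_prob /absent_minded ltnNge k_le_i iS !eqxx
      scale1r mul1r addr0.
  by rewrite /board_weight /choice_prob /absent_minded ltnNge k_le_i iS si scale0r mul0r.
rewrite mulr_sumr mulr_suml; apply: eq_big => [S|S].
  by rewrite subUset sub1set -andbA; congr (_ && _); rewrite andbC.
case/andP => /andP[/eqP cS _] iS.
rewrite tail_weight_step mulr_sumr mulr_suml [RHS]big_mkcond; apply: eq_bigr => s _.
rewrite /board_weight /choice_prob iS andbF (card_setC_ord cS).
case: ifP => [sS|sS] /=; first by rewrite scale0r mul0r mulr0.
rewrite -scalerAl scale_natVK //; case: eqP sS => [->|_ _]; first by rewrite iS.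
by rewrite mulrC.
Qed.

(** Induction on the number of passengers left: each one adds its own seat to [B], so [r] stays
    constant. *)
Lemma tail_sum_late (A : comAlgType rat) (n k : nat) (w : 'I_n -> A) (i r : nat)
    (B : {set 'I_n}) (k_le_i : (k <= i)%N) (i_le_n : (i <= n)%N)
    (B_lt : forall j, j \in B -> (j < i)%N) (cardB : (#|B| + r = i)%N) :
  (n - i)`!%:R * tail_sum k w i B =
    \prod_(j < n | (i <= j)%N) (r%:R * w j + (n - j)%:R).
Proof.
have [d] := ubnP (n - i)%N.
elim: d => // d IHd in i B k_le_i i_le_n B_lt cardB *; rewrite ltnS => le_d.
have [n_le_i|i_lt_n] := leqP n i.
  have -> : i = n by apply/eqP; rewrite eqn_leq i_le_n.
  rewrite subnn mul1r [RHS]big_pred0 => [|j]; last by rewrite leqNgt ltn_ord.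
  rewrite /tail_sum (big_pred1 setT) ?tail_weight_end // => S.
  apply/andP/eqP => [[cS _]|->]; last by rewrite cardsT card_ord eqxx subsetT.
  by apply/eqP; rewrite eqEcard subsetT cardsT card_ord (eqP cS) leqnn.
pose o := Ordinal i_lt_n.
have oB : o \notin B by apply/negP => /B_lt; rewrite ltnn.
have E : (n - i)%N = (n - i.+1).+1 by rewrite -subSn.
rewrite E factS natrM mulrAC -E (tail_sum_present w (i := o) k_le_i oB) -mulrA.
rewrite [_ * (_)`!%:R]mulrC IHd //.
- rewrite [RHS](bigD1 o) //=; congr (_ * _).
    by rewrite -[X in (X - _)%N]cardB addKn.
  by apply: eq_bigl => j; rewrite ltn_neqAle andbC eq_sym.
- exact: leqW.
- by move=> j; rewrite !inE => /predU1P[->|/B_lt/leqW].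
- by rewrite cardsU1 oB -cardB.
- by rewrite -E.
Qed.

(** The factorial absorbs the multiplicities [r.+1] that arise whenever an absent-minded passenger
    raises [r]. *)
Definition late_prod (A : comAlgType rat) (n k : nat) (w : 'I_n -> A) (r : nat) : A :=
  r`!%:R * \prod_(j < n | (k <= j)%N) (r%:R * w j + (n - j)%:R).

Definition early_poly (A : comAlgType rat) (n k : nat) (w : 'I_n -> A) (i : nat) :
    {poly A} :=
  \prod_(j < n | (i <= j < k)%N) ((1 - w j)%:P * 'X + (w j)%:P).

(* Since the coefficients are read from degree k downwards, X^|B| stands for
   the |B| passengers that are known to sit in their own seats. *)
Lemma tail_sum_early (A : comAlgType rat) (n k : nat) (w : 'I_n -> A) (i r : nat)
    (B : {set 'I_n}) (k_le_n : (k <= n)%N) (i_le_k : (i <= k)%N)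
    (B_lt : forall j, j \in B -> (j < i)%N) (cardB : (#|B| + r = i)%N) :
  r`!%:R * ((n - i)`!%:R * tail_sum k w i B) =
    \sum_(t < k.+1) ('X^#|B| * early_poly k w i)`_(k - t) * late_prod k w t.
Proof.
have [d] := ubnP (k - i)%N.
elim: d => // d IHd in i r B i_le_k B_lt cardB *; rewrite ltnS => le_d.
have [k_le_i|i_lt_k] := leqP k i.
  have Eik : i = k by apply/eqP; rewrite eqn_leq i_le_k.
  rewrite (_ : early_poly k w i = 1) ?mulr1; last first.
    by rewrite /early_poly big_pred0 // => j; rewrite Eik ltnNge andbN.
  rewrite (tail_sum_late w k_le_i _ B_lt cardB) ?Eik //.
  have r_lt : (r < k.+1)%N by rewrite ltnS -Eik -cardB leq_addl.
  have k_r : (k - r)%N = #|B| by rewrite -Eik -cardB addnK.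
  (* With no absent-minded passenger left, the monomial of degree [k - r] selects the single term
     [t = r]. *)
  rewrite [RHS](bigD1 (Ordinal r_lt)) //= [X in _ + X]big1 => [|t ne].
    by rewrite coefXn k_r eqxx mul1r addr0.
  rewrite coefXn; case: eqP => [e|]; last by rewrite mul0r.
  case/eqP: ne; apply: val_inj => /=.
  by rewrite -[t : nat](subKn (ltn_ord t : (t <= k)%N)) e -Eik -cardB addKn.
have i_lt_n := leq_trans i_lt_k k_le_n.
pose o := Ordinal i_lt_n.
have oB : o \notin B by apply/negP => /B_lt; rewrite ltnn.
have E : (n - i)%N = (n - i.+1).+1 by rewrite -subSn.
have lt_d : (k - i.+1 < d)%N by rewrite (leq_trans _ le_d) // ltn_sub2l.
have B_ltS j : j \in B -> (j < i.+1)%N by move/B_lt/leqW.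
(* The two branches for an absent-minded passenger: [r] grows, or the own seat joins [B]. *)
have IH1 := IHd i.+1 r.+1 B i_lt_k B_ltS _ lt_d.
have IH2 := IHd i.+1 r (o |: B) i_lt_k _ _ lt_d.
rewrite E factS natrM [X in _ * X]mulrAC -E (tail_sum_absent w (i := o) i_lt_k oB).
have -> : (o.+1 - #|B|)%N = r.+1 by rewrite /= -cardB -addnS addKn.
transitivity (w o * (r.+1`!%:R * ((n - i.+1)`!%:R * tail_sum k w i.+1 B))
   + (1 - w o) * (r`!%:R * ((n - i.+1)`!%:R * tail_sum k w i.+1 (o |: B)))).
  by rewrite factS natrM; ring.
rewrite IH1 ?addnS ?cardB // IH2; last 2 first.
- by move=> j; rewrite !inE => /predU1P[->|/B_ltS].
- by rewrite cardsU1 oB add1n addSn cardB.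
have -> : early_poly k w i = ((1 - w o)%:P * 'X + (w o)%:P) * early_poly k w i.+1.
  rewrite {1}/early_poly (bigD1 o) /= ?leqnn ?i_lt_k //; congr (_ * _).
  by apply: eq_bigl => j; rewrite (ltn_neqAle i) -[RHS]andbA [RHS]andbC eq_sym.
rewrite !mulr_sumr -big_split; apply: eq_bigr => t _ /=.
rewrite cardsU1 oB add1n exprS.
(* The constant term [w o] of the new factor keeps the power of X, as in the first branch; its
   linear term raises it by one, as [B] grows in the second. *)
set p := 'X^_; set q := early_poly _ _ _.
have -> : p * (((1 - w o)%:P * 'X + (w o)%:P) * q) =
  (w o)%:P * (p * q) + (1 - w o)%:P * ('X * p * q) by ring.
by rewrite coefD !coefCM; ring.
Qed.

(** Each seating counts for exactly one set of displaced passengers, and its monomial is the product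
    of the individual markers. *)
Lemma passenger_polyE (n k : nat) :
  passenger_poly n k = tail_sum k (fun i => 'X_i : {mpoly rat[n]}) 0 set0.
Proof.
rewrite /tail_sum (big_pred1 set0) => [|S]; last by rewrite sub0set andbT cards_eq0.
rewrite /passenger_poly /displaced_prob.
under eq_bigr => S _ do rewrite scaler_suml.
rewrite (exchange_big_dep xpredT) //= /tail_weight.
apply: eq_big => [f|f _]; first by apply/esym/forallP.
rewrite (big_pred1 (displaced f)) => [|S]; last by rewrite eq_sym.
rewrite /seating_prob /board_weight scaler_prod; congr (_ *: _).
  by apply: eq_bigr => i _; rewrite set0U.
by rewrite big_mkcond; apply: eq_bigr => i _; rewrite inE; case: eqP.
Qed.

Theorem theorem4 (n k : nat) (k_ge1 : (1 <= k)%N) (k_le_n : (k <= n)%N) :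
  passenger_poly n k =
    (n`!%:R)^-1 *:
      \sum_(r < k.+1)
         r`!%:R * e_poly n k (k - r) *
         \prod_(j < n | (k < j.+1)%N)
            (r%:R * 'X_j + (n%:R + 1 - j.+1%:R)).
Proof.
rewrite passenger_polyE; set w := fun i : 'I_n => _.
have := @tail_sum_early _ n k w 0 0 set0 k_le_n (leq0n k).
rewrite cards0 subn0 !mul1r => /(_ _ erefl) H.
rewrite -[LHS](scale_natVK _ (fact_gt0 n)) -scalerAr H => [|j]; last by rewrite inE.
congr (_ *: _); apply: eq_bigr => t _.
rewrite mulrCA mulrA; congr (_ * _); apply: eq_bigr => j _; congr (_ + _).
(* Since [j < n], the truncated difference [n - j] is the true one. *)
by rewrite -[j.+1]addn1 natrD opprD addrACA subrr addr0 natrB // ltnW.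
Qed.
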